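(* Let $m,\hat n,\tilde n\ge 1$ be integers, let $n=\hat n\cdot\tilde n$, and let $A\in\mathbb{R}^{m\times n}$. Suppose that $\hat x\sim\mathcal{N}(0,I_{\hat n})$ and $\tilde x\sim\mathcal{N}(0,I_{\tilde n})$ are independent, and let $\theta>2$. Then the inequality $$\|A\|_F\ge\theta^{-1}\,\|A(\tilde x\otimes\hat x)\|_2$$ holds with probability at least $1-\sqrt{2\theta}\,e^{-\theta+2}$.
   Context: $\otimes$ denotes the Kronecker product, so $\tilde x\otimes\hat x\in\mathbb{R}^n$. $\|\cdot\|_F$ is the Frobenius norm of a matrix and $\|\cdot\|_2$ applied to a vector is the Euclidean norm. $\mathcal{N}(0,I_d)$ is the standard Gaussian distribution on $\mathbb{R}^d$. *)

(* Defs.v *)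
From HB Require Import structures.
From mathcomp Require Import all_boot all_order all_algebra.
From mathcomp Require Import mxtens.
From mathcomp Require Import all_classical all_reals all_analysis.

Set Implicit Arguments.
Unset Strict Implicit.
Unset Printing Implicit Defensive.

Import Order.TTheory GRing.Theory Num.Theory.
Import numFieldNormedType.Exports.

Local Open Scope classical_set_scope.
Local Open Scope ring_scope.

(* Points of R^d that carry a distribution are d-tuples, because the library
   equips d.-tuple R with the product (Borel) sigma-algebra; tcol turns them
   into column vectors. *)
Definition tcol (R : realType) (d : nat) (x : d.-tuple R) : 'cV[R]_d :=
  \col_i tnth x i.

Definition frobenius_norm (R : realType) (m n : nat) (A : 'M[R]_(m, n)) : R :=
  Num.sqrt (\sum_i \sum_j A i j ^+ 2).

Definition euclidean_norm (R : realType) (n : nat) (v : 'cV[R]_n) : R :=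
  Num.sqrt (\sum_i v i ord0 ^+ 2).

(* The type of tensmx u v is 'M_(p * q, 1 * 1), convertible to 'cV_(p * q);
   its entry of index i * q + j is u_i * v_j, the usual Kronecker order. *)
Definition kron (R : realType) (p q : nat) (u : 'cV[R]_p) (v : 'cV[R]_q) :
  'cV[R]_(p * q) := tensmx u v.

Section std_gaussian.
Variable R : realType.

(* normal_prob lives on measurableTypeR R, whose sigma-algebra is that of R but
   whose canonical structure and display differ. *)
Definition tuple_cons (d : nat) (p : measurableTypeR R * d.-tuple R) :
    d.+1.-tuple R :=
  [the d.+1.-tuple R of (p.1 : R) :: p.2].

Let measurable_tuple_cons d : measurable_fun setT (@tuple_cons d).
Proof.
by apply: measurable_cons; [exact: measurable_fst|exact: measurable_snd].
Qed.

HB.instance Definition _ d :=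
  isMeasurableFun.Build _ _ _ _ (@tuple_cons d) (@measurable_tuple_cons d).

(* N(0, I_d): the product of d copies of N(0, 1). *)
Fixpoint std_gaussian (d : nat) : probability (d.-tuple R) R :=
  if d is d'.+1 then
    distribution (normal_prob 0 1 \x std_gaussian d')%E (@tuple_cons d')
  else dirac [tuple].

End std_gaussian.

(* Equality is required on measurable sets only, the value of a measure
   elsewhere being a formalization artefact. *)
Definition has_law d d' (T : measurableType d) (T' : measurableType d')
    (R : realType) (P : probability T R) (X : {RV P >-> T'})
    (mu : probability T' R) : Prop :=
  forall B : set T', measurable B -> distribution P X B = mu B.

Definition independent_RV d d1 d2 (T : measurableType d)
    (T1 : measurableType d1) (T2 : measurableType d2)
    (R : realType) (P : probability T R)
    (X : {RV P >-> T1}) (Y : {RV P >-> T2}) : Prop :=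
  forall (B1 : set T1) (B2 : set T2), measurable B1 -> measurable B2 ->
    P (X @^-1` B1 `&` Y @^-1` B2) = (P (X @^-1` B1) * P (Y @^-1` B2))%E.

(* Main.v *)
Require Import Defs.
From mathcomp Require Import all_boot all_order all_algebra.
From mathcomp Require Import all_classical all_reals all_analysis.
From mathcomp Require Import measurable_realfun mxtens ring lra.

Set Implicit Arguments.
Unset Strict Implicit.
Unset Printing Implicit Defensive.

Import Order.TTheory GRing.Theory Num.Theory.

Local Open Scope classical_set_scope.
Local Open Scope ring_scope.

(** Chernoff's method applied to the hyperbolic cosine of the norm.

Write $G_d$ for the law $N(0, I_d)$, let $Z = \|A(y \otimes x)\|$ with
$x \sim G_q$ and $y \sim G_p$ independent, and rescale $A$ so that
$c = \|A\|_F^2 < 1$.  The heart of the matter is the inequality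
$$ E \cosh Z \le (1 - c)^{-1/2} $$
([std_gaussian_norm_cosh]), which is an equality when $A$ has a single nonzero
entry, that is when $Z = \sqrt c\,|g h|$ for independent standard normal
variables $g$ and $h$: first $E_g \cosh(\sqrt c\,g h) = e^{c h^2 / 2}$, then
$E_h e^{c h^2 / 2} = (1 - c)^{-1/2}$.  This rank-one situation is the worst one.
Given $y$, the number $Z^2$ is a sum of squares $\sum_i \langle a_i, x
\rangle^2$ of linear forms in $x$, hence a convex combination with weights
$\|a_i\|^2 / t$, where $t = \sum_i \|a_i\|^2$, of squares of centred Gaussian
variables of the same variance $t$.  Since $z \mapsto \cosh \sqrt z$ is convex
on $[0, +\infty)$, Jensen's inequality bounds the conditional expectation by
that of a single form, $e^{t / 2}$ ([std_gaussian_jensen]).  Now $t$ is in turn a sum of squares of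
linear forms in $y$ whose squared norms add up to $c$, and the same argument
with the convex function $z \mapsto e^{z / 2}$ gives $(1 - c)^{-1/2}$.

Every Gaussian expectation that occurs is obtained from the normalisation of
normal densities: completing the square in $e^{c x} e^{- x^2 / 2}$ shifts the
mean ([normal_mgf]), and $e^{c x^2 / 2} e^{- x^2 / 2}$ is a change of variance
([normal_exp_sqr]).

For the theorem, scale $A$ so that $c = 1 - 1 / \theta$.  The expectation of
$\cosh Z$ is then at most $\sqrt \theta$, whereas on the exceptional event
$Z > \sqrt c\,\theta \ge c\,\theta = \theta - 1$.  Markov's inequality bounds
the probability of that event by $2 \sqrt \theta\, e^{1 - \theta}$, and
$2 \le \sqrt 2\, e$. *)

(** * Gaussian integrals on the line *)

(** The density of a normal distribution is a version of its Radon-Nikodym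
    derivative, for which a change of variables is available. *)
Lemma ge0_integral_normal_prob (R : realType) (m s : R)
    (f : measurableTypeR R -> \bar R) :
    measurable_fun setT f -> (forall x, (0 <= f x)%E) ->
  (\int[normal_prob m s]_x f x =
   \int[lebesgue_measure]_x (f x * (normal_pdf m s x)%:E))%E.
Proof.
move=> mf f0; have dom := @normal_prob_dominates R m s.
rewrite -(@Radon_Nikodym_SigmaFinite.change_of_variables _ _ R
  (normal_prob m s) lebesgue_measure dom f setT f0 measurableT mf).
apply: ae_eq_integral => //.
- apply: emeasurable_funM => //.
  exact: measurable_int (Radon_Nikodym_SigmaFinite.f_integrable dom).
- apply: emeasurable_funM => //.
  by apply/measurable_EFinP; exact: measurable_normal_pdf.
- apply: ae_eqe_mul2l.
  apply: (@integral_ae_eq _ _ R lebesgue_measure setT measurableT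
    (fun x => (normal_pdf m s x)%:E)).
  + exact: Radon_Nikodym_SigmaFinite.f_integrable.
  + by apply/measurable_EFinP; exact: measurable_normal_pdf.
  + by move=> E _ mE; rewrite -Radon_Nikodym_SigmaFinite.f_integral.
Qed.

(** Completing the square turns the integrand into a multiple of the density
    of mean [c]. *)
Lemma normal_mgf (R : realType) (c : R) :
  (\int[normal_prob 0 1]_x (expR (c * x))%:E =
   (expR (c ^+ 2 / 2))%:E :> \bar R)%E.
Proof.
rewrite ge0_integral_normal_prob; last 2 first.
- by apply/measurable_EFinP; apply: measurableT_comp => //;
    exact: measurable_funM.
- by move=> x; rewrite lee_fin expR_ge0.
transitivity (\int[lebesgue_measure]_x
    ((expR (c ^+ 2 / 2))%:E * (normal_pdf c 1 x)%:E) : \bar R)%E.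
  apply: eq_integral => x _; rewrite -!EFinM; congr EFin.
  rewrite !normal_pdfE ?oner_neq0// !(mulrCA _ (normal_peak 1)); congr (_ * _).
  by rewrite /normal_fun -!expRD; congr expR; field.
rewrite ge0_integralZl//; last 2 first.
- by apply/measurable_EFinP; exact: measurable_normal_pdf.
- by move=> x _; rewrite lee_fin normal_pdf_ge0.
by rewrite integral_normal_pdf mule1.
Qed.

(** The integrand is a multiple of the centred density of variance
    $(1 - c)^{-1}$. *)
Lemma normal_exp_sqr (R : realType) (c : R) : c < 1 ->
  (\int[normal_prob 0 1]_x (expR (c * x ^+ 2 / 2))%:E =
   ((Num.sqrt (1 - c))^-1)%:E :> \bar R)%E.
Proof.
move=> c1; pose r := Num.sqrt (1 - c).
have r0 : 0 < r by rewrite sqrtr_gt0 subr_gt0.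
have r2 : r ^+ 2 = 1 - c by rewrite sqr_sqrtr// subr_ge0 ltW.
rewrite ge0_integral_normal_prob; last 2 first.
- apply/measurable_EFinP; apply: measurableT_comp => //.
  by do 2! apply: measurable_funM => //; exact: measurable_funX.
- by move=> x; rewrite lee_fin expR_ge0.
transitivity (\int[lebesgue_measure]_x
    (r^-1%:E * (normal_pdf 0 r^-1 x)%:E) : \bar R)%E.
  apply: eq_integral => x _; rewrite -!EFinM; congr EFin.
  rewrite !normal_pdfE ?oner_neq0 ?invr_eq0 ?gt_eqF// mulrCA.
  rewrite [RHS]mulrA; congr (_ * _).
    rewrite /normal_peak -!mulrnAr expr1n mul1r sqrtrM ?sqr_ge0//.
    by rewrite sqrtr_sqr gtr0_norm ?invr_gt0// invfM invrK mulKf ?gt_eqF.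
  rewrite /normal_fun -!expRD; congr expR.
  have := gt_eqF r0; rewrite subr0 => /negbT r_neq0.
  have -> : c = 1 - r ^+ 2 by rewrite r2; ring.
  by field.
rewrite ge0_integralZl//; last 3 first.
- by apply/measurable_EFinP; exact: measurable_normal_pdf.
- by move=> x _; rewrite lee_fin normal_pdf_ge0.
- by rewrite lee_fin invr_ge0 ltW.
by rewrite integral_normal_pdf mule1.
Qed.

(** * Linear forms of a Gaussian vector *)

Definition dotp (R : realType) (d : nat) (a : 'I_d -> R) (x : d.-tuple R) : R :=
  \sum_i a i * tnth x i.

Lemma measurable_dotp (R : realType) (d : nat) (a : 'I_d -> R) :
  measurable_fun setT (dotp a).
Proof.
apply: measurable_sum => i; apply: measurable_funM => //.
exact: measurable_tnth.
Qed.

Lemma measurable_expR_dotp (R : realType) (d : nat) (a : 'I_d -> R) :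
  measurable_fun setT (fun x : d.-tuple R => (expR (dotp a x))%:E).
Proof.
apply/measurable_EFinP; apply: measurableT_comp => //.
exact: measurable_dotp.
Qed.

Lemma std_gaussian_mgf (R : realType) (d : nat) (a : 'I_d -> R) :
  (\int[std_gaussian R d]_x (expR (dotp a x))%:E =
   (expR ((\sum_i a i ^+ 2) / 2))%:E :> \bar R)%E.
Proof.
elim: d a => [|d IHd] a.
  rewrite [LHS]integral_dirac//; last exact: measurable_expR_dotp.
  by rewrite diracT mul1e /dotp !big_ord0 mul0r.
rewrite [LHS]ge0_integral_distribution; last 2 first.
- exact: measurable_expR_dotp.
- by move=> x; rewrite lee_fin expR_ge0.
rewrite fubini_tonelli1; last 2 first.
- by apply: measurableT_comp => //; exact: measurable_expR_dotp.
- by move=> x; rewrite lee_fin expR_ge0.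
pose a' (i : 'I_d) := a (lift ord0 i).
transitivity (\int[normal_prob 0 1]_x
    ((expR ((\sum_i a' i ^+ 2) / 2))%:E * (expR (a ord0 * x))%:E) : \bar R)%E.
  apply: eq_integral => x _; rewrite /fubini_F.
  rewrite -IHd muleC -ge0_integralZl//; last exact: measurable_expR_dotp.
  apply: eq_integral => y _ /=; rewrite -EFinM -expRD; congr (expR _)%:E.
  rewrite /dotp big_ord_recl; congr (_ + _).
  by apply: eq_bigr => i _; rewrite tnthS.
rewrite ge0_integralZl//; last first.
  by apply/measurable_EFinP; apply: measurableT_comp => //;
    exact: measurable_funM.
by rewrite normal_mgf -EFinM -expRD big_ord_recl mulrDl addrC.
Qed.

(** Writing $e^{u^2 / 2}$ as $E e^{u g}$ for an auxiliary standard normal $g$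
    linearises the square; exchanging the two expectations then reduces the
    claim to the moment generating function of the form and to an integral over
    the line. *)
Lemma std_gaussian_exp_sqr (R : realType) (d : nat) (a : 'I_d -> R) :
    \sum_i a i ^+ 2 < 1 ->
  (\int[std_gaussian R d]_x (expR (dotp a x ^+ 2 / 2))%:E =
   ((Num.sqrt (1 - \sum_i a i ^+ 2))^-1)%:E :> \bar R)%E.
Proof.
move=> a1; rewrite -normal_exp_sqr//.
transitivity (\int[std_gaussian R d]_x \int[normal_prob 0 1]_g
    (expR (dotp a x * g))%:E : \bar R)%E.
  by apply: eq_integral => x _; rewrite normal_mgf.
pose f (z : d.-tuple R * measurableTypeR R) : \bar R :=
  (expR (dotp a z.1 * z.2))%:E.
rewrite (@fubini_tonelli _ _ _ _ _ (std_gaussian R d) (normal_prob 0 1) f);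
  last 2 first.
- apply/measurable_EFinP; apply: measurableT_comp => //.
  apply: measurable_funM => //.
  by apply: measurableT_comp => //; exact: measurable_dotp.
- by move=> z; rewrite lee_fin expR_ge0.
apply: eq_integral => g _; rewrite /f /=.
pose b i := g * a i.
transitivity (\int[std_gaussian R d]_x (expR (dotp b x))%:E : \bar R)%E.
  apply: eq_integral => x _; rewrite /dotp mulrC mulr_sumr.
  by under eq_bigr do rewrite mulrA.
have -> : (\sum_i a i ^+ 2) * g ^+ 2 = \sum_i b i ^+ 2.
  by rewrite mulr_suml; apply: eq_bigr => i _; rewrite exprMn mulrC.
exact: std_gaussian_mgf.
Qed.

(** * Jensen's inequality on the half-line *)

Definition jensen_nneg (R : realType) (f : R -> R) : Prop :=
  forall (I : finType) (w z : I -> R),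
    (forall j, 0 <= w j) -> \sum_j w j = 1 -> (forall j, 0 <= z j) ->
  f (\sum_j w j * z j) <= \sum_j w j * f (z j).

(** The tangent at the weighted mean, averaged over the points, gives the value
    at the mean. *)
Lemma jensen_tangent (R : realType) (f : R -> R) :
    (forall r, 0 <= r ->
      exists l, forall z, 0 <= z -> f r + l * (z - r) <= f z) ->
  jensen_nneg f.
Proof.
move=> tan I w z w0 w1 z0; set r := \sum_j w j * z j.
have r0 : 0 <= r by apply: sumr_ge0 => j _; exact: mulr_ge0.
have [l fl] := tan r r0.
have -> : f r = \sum_j w j * (f r + l * (z j - r)).
  under eq_bigr => j _ do rewrite mulrDr mulrCA mulrBr.
  rewrite big_split/= -mulr_sumr sumrB -!mulr_suml w1 -/r.
  by rewrite !mul1r subrr mulr0 addr0.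
by apply: ler_sum => j _; rewrite ler_wpM2l// fl.
Qed.

Lemma jensen_exp_half (R : realType) : jensen_nneg (fun z : R => expR (z / 2)).
Proof.
apply: jensen_tangent => r _; exists (expR (r / 2) / 2) => z _.
have -> : z / 2 = r / 2 + (z - r) / 2 by field.
rewrite expRD -[X in X + _]mulr1 -mulrA -mulrDr ler_wpM2l ?expR_ge0//.
by rewrite mulrC expR_ge1Dx.
Qed.

Lemma jensen_exprn (R : realType) (k : nat) : jensen_nneg (fun z : R => z ^+ k).
Proof.
apply: jensen_tangent => r r0; case: k => [|k].
  by exists 0 => z _; rewrite mul0r addr0.
(* The induction multiplies the bound for the previous exponent by z; what is
   lost is a nonnegative multiple of (z - r) ^+ 2. *)
exists (k.+1%:R * r ^+ k) => z z0.
elim: k => [|k IHk]; first by rewrite expr0 !expr1; lra.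
have rk : 0 <= r ^+ k by exact: exprn_ge0.
have := ler_wpM2l z0 IHk; rewrite -exprS; apply: le_trans.
rewrite -subr_ge0 (_ : _ - _ = k.+1%:R * r ^+ k * (z - r) ^+ 2).
  by apply: mulr_ge0; [exact: mulr_ge0|exact: sqr_ge0].
by rewrite !exprS -(natr1 k.+1); ring.
Qed.

(** $\cosh \sqrt z$; with the square root as part of the function, it is convex
    as a function of a sum of squares. *)
Definition cosh_sqrt (R : realType) (z : R) : R :=
  (expR (Num.sqrt z) + expR (- Num.sqrt z)) / 2.

(** The odd terms of the exponential series of $\sqrt z$ and $- \sqrt z$ cancel,
    so that only integral powers of [z] remain. *)
Definition cosh_term (R : realType) (n : nat) (z : R) : R :=
  (~~ odd n)%:R * 2 / n`!%:R * z ^+ n./2.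

Lemma cosh_sqrt_series (R : realType) (z : R) : 0 <= z ->
  series (fun n => cosh_term n z) @ \oo -->
    expR (Num.sqrt z) + expR (- Num.sqrt z).
Proof.
move=> z0.
have -> : (fun n => cosh_term n z) =
    exp_coeff (Num.sqrt z) + exp_coeff (- Num.sqrt z).
  apply/funext => n; rewrite /cosh_term /exp_coeff /= !fctE /=.
  have sE : Num.sqrt z ^+ n = Num.sqrt z ^+ odd n * z ^+ n./2.
    by rewrite -{1}(odd_double_half n) exprD -mul2n exprM sqr_sqrtr.
  rewrite exprNn -signr_odd sE; case: (odd n) => /=; first by ring.
  by rewrite expr0; ring.
rewrite seriesD.
by apply: cvgD; exact: is_cvg_series_exp_coeff.
Qed.

(** $\cosh \sqrt z$ is a power series in [z] with nonnegative coefficients, and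
    Jensen's inequality holds for each power. *)
Lemma jensen_cosh_sqrt (R : realType) : jensen_nneg (@cosh_sqrt R).
Proof.
move=> I w z w0 w1 z0; rewrite /cosh_sqrt.
under [leRHS]eq_bigr do rewrite mulrA.
rewrite -mulr_suml ler_pM2r ?invr_gt0//.
have wz0 : 0 <= \sum_j w j * z j by apply: sumr_ge0 => j _; exact: mulr_ge0.
have lhs := cosh_sqrt_series wz0.
pose v n := \sum_j w j * series (fun n => cosh_term n (z j)) n.
have rhs : v @ \oo -->
    \sum_j w j * (expR (Num.sqrt (z j)) + expR (- Num.sqrt (z j))).
  apply: cvg_big => [|j _]; first exact: add_continuous.
  by apply: cvgMl_tmp; exact: cosh_sqrt_series.
apply: (ler_cvg_to lhs rhs); near=> n.
rewrite /v /series /=.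
under [leRHS]eq_bigr do rewrite mulr_sumr.
rewrite exchange_big/=; apply: ler_sum => k _.
rewrite /cosh_term.
under [leRHS]eq_bigr do rewrite mulrCA.
rewrite -mulr_sumr ler_wpM2l ?mulr_ge0//.
exact: jensen_exprn.
Unshelve. all: end_near. Qed.

(** * Sums of squares of linear forms *)

(** Among the families of linear forms with given total squared norm [t], a
    single form maximises the expectation of a convex function of the sum of the
    squares: after normalisation to squared norm [t], the squares of the forms
    are averaged with weights that sum to 1, and Jensen's inequality applies
    pointwise. *)
Lemma std_gaussian_jensen (R : realType) (d : nat) (I : finType) (f : R -> R)
    (C t : R) (a : I -> 'I_d -> R) :
    jensen_nneg f -> measurable_fun setT f -> (forall z, 0 <= f z) ->
    (forall b : 'I_d -> R, \sum_i b i ^+ 2 = t ->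
      (\int[std_gaussian R d]_x (f (dotp b x ^+ 2))%:E <= C%:E)%E) ->
    \sum_j \sum_i a j i ^+ 2 = t ->
  (\int[std_gaussian R d]_x (f (\sum_j dotp (a j) x ^+ 2))%:E <= C%:E)%E.
Proof.
move=> jf mf f0 fC at_.
have n0 j : 0 <= \sum_i a j i ^+ 2 by apply: sumr_ge0 => i _; exact: sqr_ge0.
(* If t = 0, all forms vanish and the zero form is the one to compare with. *)
have [t0|t0] := eqVneq t 0.
  have a0 j i : a j i = 0.
    have /eqP := at_; rewrite t0 psumr_eq0//.
    move=> /allP/(_ j (mem_index_enum _)).
    rewrite psumr_eq0; last by move=> ? _; exact: sqr_ge0.
    move=> /allP/(_ i (mem_index_enum _)).
    by rewrite sqrf_eq0 => /eqP.
  have d0 (b : 'I_d -> R) x : (forall i, b i = 0) -> dotp b x = 0.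
    by move=> b0; rewrite /dotp big1// => i _; rewrite b0 mul0r.
  have := fC (fun=> 0); rewrite big1 ?t0 => [|i _]; last by rewrite expr0n.
  move=> /(_ erefl); apply: le_trans.
  rewrite le_eqVlt; apply/orP; left; apply/eqP.
  apply: eq_integral => x _; congr (f _)%:E; rewrite d0// big1 ?expr0n// => j _.
  by rewrite d0 ?expr0n// => i; exact: a0.
have tpos : 0 < t.
  by rewrite lt_neqAle eq_sym t0/= -at_; apply: sumr_ge0 => j _; exact: n0.
pose w j := (\sum_i a j i ^+ 2) / t.
have w0 j : 0 <= w j by rewrite divr_ge0// ltW.
have w1 : \sum_j w j = 1 by rewrite -mulr_suml at_ divff.
(* If w j = 0 then a j = 0, so that the next identity, in which b j is then
   zero by the convention 0^-1 = 0, holds for every j. *)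
pose b j i := a j i / Num.sqrt (w j).
have bdot j x : w j * dotp (b j) x ^+ 2 = dotp (a j) x ^+ 2.
  have -> : dotp (b j) x = dotp (a j) x / Num.sqrt (w j).
    by rewrite /dotp mulr_suml; apply: eq_bigr => i _; rewrite /b mulrAC.
  rewrite exprMn exprVn sqr_sqrtr//.
  have [wj0|wj0] := eqVneq (w j) 0; last by rewrite mulrCA divff ?mulr1.
  rewrite wj0 mul0r; have /eqP := wj0.
  rewrite mulf_eq0 invr_eq0 (negbTE t0) orbF psumr_eq0; last first.
    by move=> ? _; exact: sqr_ge0.
  move=> /allP az; rewrite /dotp big1 ?expr0n// => i _.
  move/(_ i (mem_index_enum _)) : az; rewrite sqrf_eq0 => /eqP ->.
  by rewrite mul0r.
have bt j : w j != 0 -> \sum_i b j i ^+ 2 = t.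
  move=> wj0; under eq_bigr do rewrite exprMn exprVn sqr_sqrtr//.
  rewrite -mulr_suml; apply: (mulIf wj0); rewrite divfK// /w mulrC divfK//.
have mfb j :
    measurable_fun setT (fun x : d.-tuple R => (f (dotp (b j) x ^+ 2))%:E).
  apply/measurable_EFinP; apply: measurableT_comp => //.
  by apply: measurable_funX; exact: measurable_dotp.
apply: (@le_trans _ _
    (\int[std_gaussian R d]_x \sum_j (w j)%:E * (f (dotp (b j) x ^+ 2))%:E)%E).
  apply: ge0_le_integral => //.
  - by move=> x _; rewrite lee_fin.
  - apply/measurable_EFinP; apply: measurableT_comp => //.
    apply: measurable_sum => j.
    by apply: measurable_funX; exact: measurable_dotp.
  - by apply: emeasurable_sum => j; exact: emeasurable_funM.
  - move=> x _; under [leRHS]eq_bigr do rewrite -EFinM.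
    rewrite sumEFin lee_fin.
    under eq_bigr do rewrite -bdot.
    by apply: jf => // j; exact: sqr_ge0.
rewrite ge0_integral_sum//; last 2 first.
- by move=> j; exact: emeasurable_funM.
- by move=> j x _; rewrite -EFinM lee_fin mulr_ge0.
have -> : C = \sum_j w j * C by rewrite -mulr_suml w1 mul1r.
rewrite -sumEFin; apply: lee_sum => j _.
rewrite ge0_integralZl//; [|by move=> x _; rewrite lee_fin|by rewrite lee_fin].
rewrite (EFinM (w j)); have [->|wj0] := eqVneq (w j) 0; first by rewrite !mul0e.
by apply: lee_wpmul2l; rewrite ?lee_fin//; apply: fC; exact: bt.
Qed.

Lemma measurable_cosh_sqrt (R : realType) : measurable_fun setT (@cosh_sqrt R).
Proof.
have msqrt : measurable_fun setT (@Num.sqrt R).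
  exact: continuous_measurable_fun (@sqrt_continuous R).
rewrite /cosh_sqrt; apply: measurable_funM => //; apply: measurable_funD.
  exact: measurableT_comp.
by apply: measurableT_comp => //; exact: measurableT_comp.
Qed.

Lemma cosh_sqrt_ge0 (R : realType) (z : R) : 0 <= cosh_sqrt z.
Proof. by rewrite divr_ge0// addr_ge0// expR_ge0. Qed.

Lemma cosh_sqrt_sqr (R : realType) (y : R) :
  cosh_sqrt (y ^+ 2) = (expR y + expR (- y)) / 2.
Proof.
rewrite /cosh_sqrt sqrtr_sqr; congr (_ / _).
by have [y0|y0] := ger0P y; rewrite ?opprK// addrC.
Qed.

Lemma std_gaussian_cosh (R : realType) (d : nat) (a : 'I_d -> R) :
  (\int[std_gaussian R d]_x (cosh_sqrt (dotp a x ^+ 2))%:E =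
   (expR ((\sum_i a i ^+ 2) / 2))%:E :> \bar R)%E.
Proof.
pose a' i := - a i.
have a'E : \sum_i a' i ^+ 2 = \sum_i a i ^+ 2.
  by apply: eq_bigr => i _; rewrite sqrrN.
transitivity (\int[std_gaussian R d]_x
    (2^-1%:E * ((expR (dotp a x))%:E + (expR (dotp a' x))%:E)) : \bar R)%E.
  apply: eq_integral => x _; rewrite cosh_sqrt_sqr -EFinD -EFinM mulrC.
  congr (_ * (_ + expR _))%:E; rewrite /dotp -sumrN.
  by apply: eq_bigr => i _; rewrite mulNr.
rewrite ge0_integralZl//; last 2 first.
- by apply: emeasurable_funD; exact: measurable_expR_dotp.
- by move=> x _; rewrite -EFinD lee_fin addr_ge0// expR_ge0.
rewrite ge0_integralD//; last 2 first.
- exact: measurable_expR_dotp.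
- exact: measurable_expR_dotp.
rewrite !std_gaussian_mgf a'E -EFinD -EFinM; congr EFin.
by field.
Qed.

(** * The norm of a matrix applied to a Kronecker product *)

Lemma sum_mxtens (V : nmodType) (p q : nat) (F : 'I_(p * q) -> V) :
  \sum_j F j = \sum_l \sum_k F (mxtens_index (l, k)).
Proof.
rewrite pair_bigA/= (reindex_onto (@mxtens_index p q) (@mxtens_unindex p q))/=.
  by apply: eq_big => [[l k]|[l k] _//]; rewrite mxtens_indexK eqxx.
by move=> j _; exact: mxtens_unindexK.
Qed.

(** The vectors that represent the entries of $A (y \otimes I_q)$ as linear
    forms in $y$. *)
Definition kron_row (R : realType) (m p q : nat) (A : 'M[R]_(m, p * q))
    (i : 'I_m) (k : 'I_q) (l : 'I_p) : R := A i (mxtens_index (l, k)).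

Lemma mulmx_kronE (R : realType) (m p q : nat) (A : 'M[R]_(m, p * q))
    (y : p.-tuple R) (x : q.-tuple R) (i : 'I_m) :
  (A *m kron (tcol y) (tcol x)) i ord0 =
  dotp (fun k => dotp (kron_row A i k) y) x.
Proof.
rewrite mxE sum_mxtens exchange_big/=.
apply: eq_bigr => k _; rewrite /dotp mulr_suml; apply: eq_bigr => l _.
by rewrite !mxE mxtens_indexK/= mulrA.
Qed.

Lemma sum_kron_row_sqr (R : realType) (m p q : nat) (A : 'M[R]_(m, p * q)) :
  \sum_(ik : 'I_m * 'I_q) \sum_l kron_row A ik.1 ik.2 l ^+ 2 =
  \sum_i \sum_j A i j ^+ 2.
Proof.
rewrite -(pair_bigA _ (fun i k => \sum_l kron_row A i k l ^+ 2))/=.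
by apply: eq_bigr => i _; rewrite exchange_big/= sum_mxtens.
Qed.

(** $\cosh \|A (y \otimes x)\|$ at [z = (x, y)], with the squared norm expanded
    as a sum of squares of linear forms in $x$, the shape to which
    [std_gaussian_jensen] applies. *)
Definition norm_cosh (R : realType) (m p q : nat) (A : 'M[R]_(m, p * q))
    (z : q.-tuple R * p.-tuple R) : R :=
  cosh_sqrt (\sum_i dotp (fun k => dotp (kron_row A i k) z.2) z.1 ^+ 2).

Lemma norm_coshE (R : realType) (m p q : nat) (A : 'M[R]_(m, p * q))
    (x : q.-tuple R) (y : p.-tuple R) :
  norm_cosh A (x, y) =
  (expR (euclidean_norm (A *m kron (tcol y) (tcol x))) +
   expR (- euclidean_norm (A *m kron (tcol y) (tcol x)))) / 2.
Proof.
rewrite /norm_cosh /cosh_sqrt /euclidean_norm /=.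
by under [in RHS]eq_bigr do rewrite mulmx_kronE.
Qed.

Lemma measurable_norm_cosh (R : realType) (m p q : nat) (A : 'M[R]_(m, p * q)) :
  measurable_fun setT (norm_cosh A).
Proof.
apply: measurableT_comp; first exact: measurable_cosh_sqrt.
apply: measurable_sum => i; apply: measurable_funX.
apply: measurable_sum => k; apply: measurable_funM.
  by apply: measurableT_comp => //; exact: measurable_dotp.
exact: (measurableT_comp (measurable_tnth k) measurable_fst).
Qed.

(** The comparison with a single linear form is used twice: for $x$ with $y$
    fixed, which leaves $e^{t / 2}$ with $t = \|A (y \otimes I_q)\|_F^2$, and then
    for $y$ with the function $e^{t / 2}$ of that sum of squares. *)
Lemma std_gaussian_norm_cosh (R : realType) (m p q : nat)
    (A : 'M[R]_(m, p * q)) :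
    \sum_i \sum_j A i j ^+ 2 < 1 ->
  (\int[(std_gaussian R q \x std_gaussian R p)%E]_z (norm_cosh A z)%:E <=
   ((Num.sqrt (1 - \sum_i \sum_j A i j ^+ 2))^-1)%:E)%E.
Proof.
move=> A1; rewrite fubini_tonelli2; last 2 first.
- by apply/measurable_EFinP; exact: measurable_norm_cosh.
- by move=> z; rewrite lee_fin cosh_sqrt_ge0.
apply: (@le_trans _ _ (\int[std_gaussian R p]_y (expR
    ((\sum_(ik : 'I_m * 'I_q) dotp (kron_row A ik.1 ik.2) y ^+ 2) / 2))%:E)%E).
  apply: ge0_le_integral => //.
  - by move=> y _; apply: integral_ge0 => x _; rewrite lee_fin cosh_sqrt_ge0.
  - apply: measurable_fun_fubini_tonelli_G => //.
      by apply/measurable_EFinP; exact: measurable_norm_cosh.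
    by move=> z; rewrite lee_fin cosh_sqrt_ge0.
  - apply/measurable_EFinP; apply: measurableT_comp => //.
    apply: measurable_funM => //; apply: measurable_sum => ik.
    by apply: measurable_funX; exact: measurable_dotp.
  - move=> y _; apply: (@std_gaussian_jensen R q 'I_m (@cosh_sqrt R) _ _
      (fun i k => dotp (kron_row A i k) y) (@jensen_cosh_sqrt R)
      (@measurable_cosh_sqrt R) (@cosh_sqrt_ge0 R)).
    + by move=> b bE; rewrite std_gaussian_cosh bE.
    + by rewrite pair_bigA.
apply: (@std_gaussian_jensen R p ('I_m * 'I_q)%type (fun z => expR (z / 2)) _
  (\sum_i \sum_j A i j ^+ 2) (fun ik => kron_row A ik.1 ik.2)
  (@jensen_exp_half R)).
- by apply: measurableT_comp => //; exact: measurable_funM.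
- by move=> z; exact: expR_ge0.
- by move=> b bE; rewrite std_gaussian_exp_sqr bE.
- exact: sum_kron_row_sqr.
Qed.

(** * The tail bound *)

(** A measure on a product is determined by its values on rectangles, where
    independence gives the product of the marginal laws. *)
Lemma ge0_integral_independent (d d1 d2 : measure_display)
    (T : measurableType d) (T1 : measurableType d1) (T2 : measurableType d2)
    (R : realType) (P : probability T R)
    (X : {RV P >-> T1}) (Y : {RV P >-> T2})
    (mu : probability T1 R) (nu : probability T2 R) (f : T1 * T2 -> \bar R) :
    has_law X mu -> has_law Y nu -> independent_RV X Y ->
    measurable_fun setT f -> (forall z, (0 <= f z)%E) ->
  (\int[P]_t f (X t, Y t) = \int[(mu \x nu)%E]_z f z)%E.
Proof.
move=> lawX lawY XY mf f0; pose XYt t := (X t, Y t).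
have mXY : measurable_fun setT XYt by exact: measurable_fun_pair.
rewrite -[LHS](ge0_integral_pushforward mXY P measurableT mf)//.
apply: eq_measure_integral => D mD _; apply/esym.
apply: product_measure_unique => // A B mA mB.
apply: (etrans (XY _ _ mA mB)).
by congr (_ * _)%E; [exact: lawX|exact: lawY].
Qed.

Lemma measurable_norm_mulmx_kron (R : realType) (m p q : nat)
    (A : 'M[R]_(m, p * q)) :
  measurable_fun setT (fun z : q.-tuple R * p.-tuple R =>
    euclidean_norm (A *m kron (tcol z.2) (tcol z.1))).
Proof.
have msqrt : measurable_fun setT (@Num.sqrt R).
  exact: continuous_measurable_fun (@sqrt_continuous R).
apply: measurableT_comp => //; apply: measurable_sum => i.
under eq_fun do rewrite mulmx_kronE.
apply: measurable_funX.
apply: measurable_sum => k; apply: measurable_funM.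
  by apply: measurableT_comp => //; exact: measurable_dotp.
exact: (measurableT_comp (measurable_tnth k) measurable_fst).
Qed.

Lemma euclidean_normZ (R : realType) (n : nat) (s : R) (v : 'cV[R]_n) :
  0 <= s -> euclidean_norm (s *: v) = s * euclidean_norm v.
Proof.
move=> s0; rewrite /euclidean_norm.
under eq_bigr do rewrite mxE exprMn.
by rewrite -mulr_sumr sqrtrM ?sqr_ge0// sqrtr_sqr ger0_norm.
Qed.

(** With $s^2 F = 1 - 1/\theta$, a value of $N$ above $\theta \sqrt F$
    makes $s N$ exceed $\theta \sqrt{1 - 1/\theta}$, which is at least
    $\theta (1 - 1/\theta)$ because $1 - 1/\theta$ is at most 1. *)
Lemma chernoff_threshold (R : realType) (theta F N : R) :
    1 < theta -> 0 < F ->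
    Num.sqrt ((1 - theta^-1) / F) * N < theta - 1 ->
  N <= Num.sqrt F * theta.
Proof.
move=> theta1 Fpos; set c := 1 - theta^-1; set s := Num.sqrt _ => Nlt.
have theta0 : 0 < theta by lra.
have c0 : 0 <= c by rewrite subr_ge0 invf_le1// ltW.
have c1 : c <= 1 by rewrite lerBlDr lerDl invr_ge0 ltW.
have sF : s * Num.sqrt F = Num.sqrt c.
  rewrite /s sqrtrM// -mulrA -sqrtrM ?invr_ge0 ?ltW//.
  by rewrite mulVf ?gt_eqF// sqrtr1 mulr1.
rewrite leNgt; apply/negP => /ltW NF.
move: Nlt; apply/negP; rewrite -leNgt.
apply: (@le_trans _ _ (s * (Num.sqrt F * theta))).
  rewrite mulrA sF.
  have -> : theta - 1 = c * theta by rewrite /c mulrBl mul1r mulVf// gt_eqF.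
  rewrite ler_pM2r// -[leLHS]sqr_sqrtr// expr2 ler_piMr//.
  by rewrite -sqrtr1 ler_sqrt.
by apply: ler_wpM2l => //; exact: sqrtr_ge0.
Qed.

Lemma chernoff_constant (R : realType) (theta : R) : 2 < theta ->
  2 * Num.sqrt theta * expR (1 - theta) <=
  Num.sqrt (2 * theta) * expR (- theta + 2).
Proof.
move=> theta2.
have -> : - theta + 2 = 1 + (1 - theta) by ring.
have e2 : 2 <= expR 1 :> R by have := @expR_ge1Dx R 1.
have s1 : 1 <= Num.sqrt 2 :> R by rewrite -[leLHS]sqrtr1 ler_sqrt// ler1n.
rewrite (expRD 1 (1 - theta)) sqrtrM// mulrA ler_wpM2r ?expR_ge0//.
rewrite [leRHS]mulrAC ler_wpM2r//.
by rewrite -[leLHS]mul1r ler_pM.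
Qed.

Theorem theorem2p4 (R : realType) (m nhat ntilde : nat)
  (hm : (0 < m)%N) (hnhat : (0 < nhat)%N) (hntilde : (0 < ntilde)%N)
  (A : 'M[R]_(m, ntilde * nhat))
  (d : measure_display) (T : measurableType d) (P : probability T R)
  (xhat : {RV P >-> nhat.-tuple R}) (xtilde : {RV P >-> ntilde.-tuple R})
  (law_xhat : has_law xhat (std_gaussian R nhat))
  (law_xtilde : has_law xtilde (std_gaussian R ntilde))
  (indep : independent_RV xhat xtilde)
  (theta : R) (htheta : 2 < theta) :
  ((1 - Num.sqrt (2 * theta) * expR (- theta + 2))%:E <=
   P [set t | (theta^-1 * euclidean_norm
                 (A *m kron (tcol (xtilde t)) (tcol (xhat t)))
               <= frobenius_norm A)%R])%E.
Proof.
set eps := _ * expR _.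
have theta0 : 0 < theta by lra.
pose F := \sum_i \sum_j A i j ^+ 2.
have F0 : 0 <= F by do 2! apply: sumr_ge0 => ? _; exact: sqr_ge0.
pose N t := euclidean_norm (A *m kron (tcol (xtilde t)) (tcol (xhat t))).
have mpair : measurable_fun setT (fun t => (xhat t, xtilde t)).
  exact: measurable_fun_pair.
have mN : measurable_fun setT N.
  exact: (measurableT_comp (measurable_norm_mulmx_kron A) mpair).
set good := [set t | _].
have mgood : measurable good.
  rewrite -[good]setTI; apply: (@measurable_fun_le _ _ _ setT
    (fun t => theta^-1 * N t) (cst (frobenius_norm A))) => //.
  exact: measurable_funM.
have [FE|Fneq0] := eqVneq F 0.
  suff -> : good = setT.
    by rewrite probability_setT lee_fin lerBlDr lerDl mulr_ge0 ?expR_ge0.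
  apply/seteqP; split => // t _; rewrite /good /=.
  have -> : A = 0.
    apply/matrixP => i j; rewrite mxE; apply/eqP; rewrite -sqrf_eq0; apply/eqP.
    have /eqP := FE; rewrite /F pair_bigA psumr_eq0; last first.
      by move=> ? _; exact: sqr_ge0.
    by move=> /allP/(_ (i, j) (mem_index_enum _))/eqP.
  rewrite mul0mx -[X in euclidean_norm X](scale0r 0) euclidean_normZ//.
  by rewrite mul0r mulr0 sqrtr_ge0.
have Fpos : 0 < F by rewrite lt_neqAle eq_sym Fneq0.
(* This scaling balances the growth of (1 - c)^(-1/2) against the threshold. *)
pose c := 1 - theta^-1.
have c0 : 0 <= c by rewrite subr_ge0 invf_le1//; lra.
pose s := Num.sqrt (c / F).
have BF : \sum_i \sum_j (s *: A) i j ^+ 2 = c.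
  under eq_bigr do under eq_bigr do rewrite mxE exprMn.
  under eq_bigr do rewrite -mulr_sumr.
  by rewrite -mulr_sumr -/F sqr_sqrtr ?divfK// divr_ge0.
have int_le : (\int[P]_t (norm_cosh (s *: A) (xhat t, xtilde t))%:E <=
    (Num.sqrt theta)%:E)%E.
  rewrite (@ge0_integral_independent _ _ _ _ _ _ _ _ _ _ _ _
    (fun z => (norm_cosh (s *: A) z)%:E) law_xhat law_xtilde indep);
    last 2 first.
  - by apply/measurable_EFinP; exact: measurable_norm_cosh.
  - by move=> z; rewrite lee_fin cosh_sqrt_ge0.
  have -> : Num.sqrt theta = (Num.sqrt (1 - c))^-1.
    by rewrite /c subKr -sqrtrV ?invrK// invr_ge0 ltW.
  rewrite -BF; apply: std_gaussian_norm_cosh.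
  by rewrite BF /c ltrBlDr ltrDl invr_gt0.
pose a := expR (theta - 1) / 2.
have a0 : 0 < a by rewrite divr_gt0// expR_gt0.
pose G t := (norm_cosh (s *: A) (xhat t, xtilde t))%:E.
have mG : measurable_fun setT G.
  apply/measurable_EFinP.
  exact: (measurableT_comp (measurable_norm_cosh (s *: A)) mpair).
(* On the complement of E the norm is small, since cosh is at least exp / 2. *)
pose E := [set t | (a%:E <= `|G t|)%E].
have mE : measurable E.
  rewrite -[E]setTI; apply: emeasurable_fun_c_infty => //.
  exact: measurableT_comp.
have PE : (P E <= eps%:E)%E.
  have := le_integral_abse P measurableT mG a0; rewrite setTI -/E => markovE.
  have {}markovE : (a%:E * P E <= (Num.sqrt theta)%:E)%E.
    apply: (le_trans markovE); apply: le_trans int_le.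
    rewrite le_eqVlt; apply/orP; left; apply/eqP.
    by apply: eq_integral => t _; rewrite gee0_abs// lee_fin cosh_sqrt_ge0.
  rewrite -(@lee_pmul2l _ a%:E)//; apply: (le_trans markovE).
  rewrite -EFinM lee_fin mulrC -ler_pdivrMr//.
  apply: le_trans (chernoff_constant htheta).
  rewrite /a invf_div -expRN opprB mulrA (mulrC 2).
  by rewrite -!mulrA mulrC.
have EG : ~` E `<=` good.
  move=> t /= /negP; rewrite -ltNge gee0_abs ?lee_fin ?cosh_sqrt_ge0//.
  rewrite lte_fin norm_coshE -scalemxAl euclidean_normZ ?sqrtr_ge0// -/(N t).
  rewrite ltr_pM2r ?invr_gt0// => Nlt.
  have : expR (s * N t) < expR (theta - 1).
    by apply: le_lt_trans Nlt; rewrite lerDl expR_ge0.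
  rewrite ltr_expR => {}Nlt.
  rewrite /good /= mulrC ler_pdivrMr//; apply: chernoff_threshold => //.
  by apply: lt_trans htheta; rewrite ltr1n.
apply: (@le_trans _ _ (P (~` E))).
  rewrite probability_setC// EFinB; apply: leeB => //.
by apply: le_measure; rewrite ?inE//; exact: measurableC.
Qed.
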